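(* Let $\tau_a,\tau_b\in C^0([0,1];[0,+\infty))$ be non-decreasing and convex, one of the two being strictly convex. Then there exists a constant travel time $\tilde\tau\in[0,+\infty)$ such that the five-road network in which road $e$ has constant travel time $\tilde\tau$ admits a partition $(\theta_*,\theta_* )\in S^2$ which is a local Nash point and also minimizes the mean global travel time $T$ over $S^2$.
   Context: $S^2=\{(\theta_1,\theta_2)\in[0,1]^2 : \theta_1+\theta_2\le 1\}$. Five-road network: a unit (normalized) total inflow goes from $A$ to $B$ through two intermediate junctions $P,Q$. Roads: $a$ from $A$ to $P$, $b$ from $P$ to $B$, $c$ from $A$ to $Q$, $d$ from $Q$ to $B$, $e$ from $P$ to $Q$. Roads $a,d$ have the same travel time function $\tau_a$, roads $b,c$ the same travel time function $\tau_b$ (functions of the fraction of the total inflow using the road), and road $e$ has constant travel time $\tilde\tau$. The routes are $\alpha=(a,b)$, $\beta=(c,d)$, $\gamma=(a,e,d)$. A state (partition) is $(\theta_1,\theta_2)\in S^2$, where $\theta_1,\theta_2$ and $\theta_3=1-\theta_1-\theta_2$ are the fractions of drivers using $\alpha,\beta,\gamma$ respectively. Route travel times: $$\tau_\alpha(\theta_1,\theta_2)=\tau_a(1-\theta_2)+\tau_b(\theta_1),\qquad \tau_\beta(\theta_1,\theta_2)=\tau_b(\theta_2)+\tau_a(1-\theta_1),$$ $$\tau_\gamma(\theta_1,\theta_2)=\tau_a(1-\theta_2)+\tilde\tau+\tau_a(1-\theta_1).$$ Mean global travel time: $$T(\theta_1,\theta_2)=\theta_1\tau_\alpha(\theta_1,\theta_2)+\theta_2\tau_\beta(\theta_1,\theta_2)+(1-\theta_1-\theta_2)\tau_\gamma(\theta_1,\theta_2).$$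 Equilibrium state: a state at which all routes with nonzero fraction have the same travel time. Local Nash point (Nash optimal state): an equilibrium state such that there exists $\delta>0$ with the following property: for all $\epsilon\in(0,\delta]$ and all routes $j\neq k$ in $\{\alpha,\beta,\gamma\}$, if moving a fraction $\epsilon$ of drivers from route $k$ to route $j$ gives an admissible state (all three fractions remain in $[0,1]$), then the travel time of route $j$ at the new state is strictly larger than the travel time of route $k$ at the original state. *)

(* Defs.v *)
From HB Require Import structures.
From mathcomp Require Import all_boot all_order all_algebra.
From mathcomp Require Import all_classical all_reals all_analysis.
Set Implicit Arguments.
Unset Strict Implicit.
Unset Printing Implicit Defensive.
Import Order.TTheory GRing.Theory Num.Theory.
Import numFieldNormedType.Exports.
Local Open Scope classical_set_scope.
Local Open Scope ring_scope.
Local Open Scope convex_scope.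

(* Strict counterpart of [convex_function]: distinct points, 0 < t < 1. *)
Definition strictly_convex_function (R : numFieldType) (E : lmodType R)
    (E' := convex_lmodType E) (D : set E') (f : E' -> R^o) :=
  forall t : {i01 R}, 0 < t%:num < 1 ->
    {in D &, forall x y : E', x != y ->
      (f (x <| t |> y) < f x <| t |> f y)%R}.

(* Only the values of [f] on [0, 1] matter: this describes the non-decreasing,
   convex elements of C^0([0, 1]; [0, +oo[). *)
Definition travel_time_function (R : realType) (f : R -> R) : Prop :=
  [/\ {within `[0, 1]%classic, continuous f},
      {in `[0, 1], forall x, 0 <= f x},
      {in `[0, 1] &, {homo f : x y / x <= y}} &
      convex_function (`[0, 1]%classic : set R) f].

Inductive route : Set := alpha | beta | gamma.

Definition S2 (R : realType) : set (R * R) :=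
  [set p | [/\ 0 <= p.1 <= 1, 0 <= p.2 <= 1 & p.1 + p.2 <= 1]].

Definition fraction (R : realType) (p : R * R) (j : route) : R :=
  match j with
  | alpha => p.1
  | beta => p.2
  | gamma => 1 - p.1 - p.2
  end.

(* Road [a] carries the routes alpha and gamma, hence the fraction 1 - p.2;
   road [d] carries beta and gamma, hence 1 - p.1. *)
Definition route_time (R : realType) (ta tb : R -> R) (te : R)
    (p : R * R) (j : route) : R :=
  match j with
  | alpha => ta (1 - p.2) + tb p.1
  | beta => tb p.2 + ta (1 - p.1)
  | gamma => ta (1 - p.2) + te + ta (1 - p.1)
  end.

Definition mean_time (R : realType) (ta tb : R -> R) (te : R)
    (p : R * R) : R :=
  p.1 * route_time ta tb te p alpha + p.2 * route_time ta tb te p beta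
  + (1 - p.1 - p.2) * route_time ta tb te p gamma.

Definition equilibrium (R : realType) (ta tb : R -> R) (te : R)
    (p : R * R) : Prop :=
  S2 p /\
  forall j k : route, fraction p j != 0 -> fraction p k != 0 ->
    route_time ta tb te p j = route_time ta tb te p k.

(* The state in which all drivers use route [j]. *)
Definition pure_state (R : realType) (j : route) : R * R :=
  match j with
  | alpha => (1, 0)
  | beta => (0, 1)
  | gamma => (0, 0)
  end.

(* The fraction of [j] increases by [eps], that of [k] decreases by [eps], and
   the remaining one is unchanged. *)
Definition move (R : realType) (eps : R) (k j : route) (p : R * R) : R * R :=
  (p.1 + eps * ((pure_state R j).1 - (pure_state R k).1),
   p.2 + eps * ((pure_state R j).2 - (pure_state R k).2)).

Definition local_nash (R : realType) (ta tb : R -> R) (te : R)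
    (p : R * R) : Prop :=
  equilibrium ta tb te p /\
  exists2 delta : R, 0 < delta &
    forall eps : R, 0 < eps <= delta ->
    forall j k : route, j <> k ->
      (forall i : route, 0 <= fraction (move eps k j p) i <= 1) ->
      route_time ta tb te p k < route_time ta tb te (move eps k j p) j.

(* Main.v *)
Require Import Defs.
From mathcomp Require Import all_boot all_order all_algebra.
From mathcomp Require Import all_classical all_reals all_analysis.
From mathcomp Require Import ring lra.
Set Implicit Arguments.
Unset Strict Implicit.
Import Order.TTheory GRing.Theory Num.Theory.
Import numFieldNormedType.Exports.
Local Open Scope classical_set_scope.
Local Open Scope ring_scope.

(** If the link [e] is slow enough, nobody should use the route gamma, so the
    partition with half of the drivers on alpha and half on beta is both
    socially optimal and stable; the travel time of [e] is taken to be
    [te = tb 1 + 1].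

    Optimality.  Summed over the roads, the mean time is
      [g p.1 + g p.2 + te * (1 - p.1 - p.2)]
    with [g x = (1 - x) * ta (1 - x) + x * tb x].  A road with load [x] costs
    [x * f x] in total, and this cost is midpoint convex when the travel time
    [f] is non-decreasing and convex ([road_cost_midpoint]).  Hence replacing
    both fractions by their mean [s <= 1/2] does not increase the mean time
    ([mean_time_diagonal_le]).  On the diagonal, raising [s] to [1/2] saves
    [te] per driver taken off gamma, which outweighs the growth of the cost of
    the roads [b] and [c] because that growth is controlled by [tb 1]
    ([mean_time_half_le]).

    Stability.  A driver moving from alpha or beta to gamma leaves [b] or [c],
    where the time was [tb (1/2)], for the road [e], which alone takes the
    larger time [te], and for a further road [d] or [a].  A move between alpha
    and beta raises the load of both roads of the target route, and one of the
    two travel times is strictly increasing ([strictly_convex_increasing]).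
    There are no drivers to move away from gamma. *)

Section TravelTime.
Variables (R : realType) (f : R -> R).

Lemma convex_function01 (t x y : R) :
  convex_function (`[0, 1]%classic : set R) f ->
  0 <= t <= 1 -> 0 <= x <= 1 -> 0 <= y <= 1 ->
  f (t * x + (1 - t) * y) <= t * f x + (1 - t) * f y.
Proof.
move=> cf /andP[t0 t1] x01 y01.
by apply: (cf (Itv01 t0 t1)); rewrite inE /= in_itv.
Qed.

(** Were the two values equal, monotonicity would make [f] constant between the
    two points, against strict convexity at their midpoint. *)
Lemma strictly_convex_increasing (x y : R) :
  {in `[0, 1] &, {homo f : x y / x <= y}} ->
  strictly_convex_function (`[0, 1]%classic : set R) f ->
  0 <= x -> x < y -> y <= 1 -> f x < f y.
Proof.
move=> homof scf x0 xy y1.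
have h0 : 0 <= 2^-1 :> R by lra.
have h1 : 2^-1 <= 1 :> R by lra.
have mid : f (2^-1 * x + (1 - 2^-1) * y) < 2^-1 * f x + (1 - 2^-1) * f y.
  apply: (scf (Itv01 h0 h1)) => /=; first by apply/andP; split; lra.
  - by rewrite inE /= in_itv /=; apply/andP; split; lra.
  - by rewrite inE /= in_itv /=; apply/andP; split; lra.
  - by rewrite lt_eqF.
have : f x <= f (2^-1 * x + (1 - 2^-1) * y).
  by apply: homof; rewrite ?in_itv /=; try (apply/andP; split); lra.
by lra.
Qed.

Hypothesis hf : travel_time_function f.

Lemma travel_time_ge0 (x : R) : 0 <= x <= 1 -> 0 <= f x.
Proof. by case: hf => _ + _ _ x01; apply; rewrite in_itv. Qed.

Lemma travel_time_le (x y : R) : 0 <= x -> x <= y -> y <= 1 -> f x <= f y.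
Proof.
case: hf => _ _ homof _ x0 xy y1.
by apply: homof; rewrite ?in_itv //=; apply/andP; split; lra.
Qed.

(** Chebyshev's inequality for two similarly ordered pairs gives
    [x * f x + y * f y >= (x + y) * ((f x + f y) / 2)]; the second factor is at
    least the value of [f] at the midpoint. *)
Lemma road_cost_midpoint (x y : R) : 0 <= x <= 1 -> 0 <= y <= 1 ->
  (x + y) * f ((x + y) / 2) <= x * f x + y * f y.
Proof.
move=> x01 y01; have [_ _ _ cf] := hf.
have h01 : 0 <= (2^-1 : R) <= 1 by lra.
have mid := convex_function01 cf h01 x01 y01.
have Em : 2^-1 * x + (1 - 2^-1) * y = (x + y) / 2 by field.
rewrite {}Em in mid.
have cheb : 0 <= (x - y) * (f x - f y).
  have [xy|yx] := leP x y.
    by have := @travel_time_le x y; nra.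
  by have := @travel_time_le y x; nra.
by nra.
Qed.

(** The slope of a convex function to the left of [1/2] is at most its slope
    between [1/2] and [1]; the denominators are cleared. *)
Lemma travel_time_half_le (s : R) : 0 <= s <= 2^-1 ->
  2 * (1 - s) * f 2^-1 <= f s + (1 - 2 * s) * f 1.
Proof.
move=> /andP[s0 sh]; have [_ _ _ cf] := hf.
have d0 : 0 < 1 - s by lra.
(* 1/2 = t * s + (1 - t) * 1 *)
pose t := (2 * (1 - s))^-1.
have Et : t * (2 * (1 - s)) = 1 by rewrite /t mulVf //; apply/eqP; lra.
have t01 : 0 <= t <= 1 by apply/andP; split; nra.
have s01 : 0 <= s <= 1 by lra.
have l01 : 0 <= (1 : R) <= 1 by lra.
have := convex_function01 cf t01 s01 l01.
have -> : t * s + (1 - t) * 1 = 2^-1 by lra.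
move=> conv; have d2 : 0 <= 2 * (1 - s) by lra.
have := ler_wpM2l d2 conv.
have -> : 2 * (1 - s) * (t * f s + (1 - t) * f 1) =
  (t * (2 * (1 - s))) * f s + (2 * (1 - s) - t * (2 * (1 - s))) * f 1 by ring.
by rewrite Et; lra.
Qed.

End TravelTime.

Section Network.
Variables (R : realType) (ta tb : R -> R).
Hypotheses (hta : travel_time_function ta) (htb : travel_time_function tb).

Lemma mean_time_diagonal_le (te : R) (p : R * R) : S2 p ->
  mean_time ta tb te ((p.1 + p.2) / 2, (p.1 + p.2) / 2)
    <= mean_time ta tb te p.
Proof.
case: p => x y [/= x01 y01 xy].
have x01' : 0 <= 1 - x <= 1 by lra.
have y01' : 0 <= 1 - y <= 1 by lra.
have := road_cost_midpoint hta x01' y01'.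
have -> : (1 - x + (1 - y)) / 2 = 1 - (x + y) / 2 by field.
have := road_cost_midpoint htb x01 y01.
rewrite /mean_time /=.
by lra.
Qed.

(** Multiplying [travel_time_half_le] by [2 * s] bounds the cost of [b] and [c]
    from below; what remains is [4 * s * (1 - s) + (1 - 2 * s)^2 = 1] together with
    [tb (1/2) <= tb 1].  The roads [a] and [d] only get less loaded as [s]
    grows. *)
Lemma mean_time_half_le (te s : R) : tb 1 <= te -> 0 <= s <= 2^-1 ->
  mean_time ta tb te (2^-1, 2^-1) <= mean_time ta tb te (s, s).
Proof.
move=> te1 s01; have /andP[s0 sh] := s01.
have E : 1 - 2^-1 = 2^-1 :> R by lra.
have h01 : 0 <= (2^-1 : R) <= 1 by lra.
have A0 := travel_time_ge0 hta h01.
have A1 : ta 2^-1 <= ta (1 - s) by apply: (travel_time_le hta); lra.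
have B1 : tb 2^-1 <= tb 1 by apply: (travel_time_le htb); lra.
have sec := ler_wpM2l (mulr_ge0 (ler0n R 2) s0) (travel_time_half_le htb s01).
have costa : ta 2^-1 <= 2 * (1 - s) * ta (1 - s) by nra.
have costb : tb 2^-1 <= 2 * s * tb s + (1 - 2 * s) * tb 1.
  by have := mulr_ge0 (sqr_ge0 (1 - 2 * s)) (_ : 0 <= tb 1 - tb 2^-1);
     rewrite subr_ge0 => /(_ B1); lra.
have saving : (1 - 2 * s) * tb 1 <= (1 - 2 * s) * te.
  by apply: ler_wpM2l => //; lra.
by rewrite /mean_time /= E; lra.
Qed.

Lemma half_minimizes_mean_time (te : R) (p : R * R) : tb 1 <= te -> S2 p ->
  mean_time ta tb te (2^-1, 2^-1) <= mean_time ta tb te p.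
Proof.
move=> te1 Sp; apply: le_trans (mean_time_diagonal_le te Sp).
case: Sp => p1 p2 p12.
by apply: mean_time_half_le => //; lra.
Qed.

Lemma half_local_nash (te : R) :
  strictly_convex_function (`[0, 1]%classic : set R) ta \/
  strictly_convex_function (`[0, 1]%classic : set R) tb ->
  tb 2^-1 < te -> local_nash ta tb te (2^-1, 2^-1).
Proof.
move=> hstrict te_gt.
have [_ _ homoa _] := hta; have [_ _ homob _] := htb.
have E : 1 - 2^-1 = 2^-1 :> R by lra.
have E0 : 1 - 2^-1 - 2^-1 = 0 :> R by lra.
split; first split.
- by split => /=; lra.
- by move=> [] [] //=; rewrite ?E0 ?eqxx // => _ _; rewrite E addrC.
exists 1; first exact: ltr01.
move=> eps /andP[eps0 _] j k jk adm.
have kNg : k <> gamma.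
  by move=> Ek; have := adm gamma; rewrite Ek in jk *; case: j jk {adm} => /= jk;
     (congruence || lra).
have epsh : eps <= 2^-1.
  (* the route left by a fraction [eps] is used by half of the drivers *)
  by have := adm k; case: k j kNg jk {adm} => [] [] //= _ _; lra.
have h01 : 0 <= (2^-1 : R) <= 1 by lra.
have a_ge0 := travel_time_ge0 hta h01.
have a_le : ta 2^-1 <= ta (2^-1 + eps) by apply: (travel_time_le hta); lra.
have b_le : tb 2^-1 <= tb (2^-1 + eps) by apply: (travel_time_le htb); lra.
have ab_lt : ta 2^-1 + tb 2^-1 < ta (2^-1 + eps) + tb (2^-1 + eps).
  case: hstrict => sc.
  - have : ta 2^-1 < ta (2^-1 + eps).
      by apply: strictly_convex_increasing => //; lra.
    by lra.
  - have : tb 2^-1 < tb (2^-1 + eps).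
      by apply: strictly_convex_increasing => //; lra.
    by lra.
have Ep : 2^-1 + eps * (1 - 0) = 2^-1 + eps by ring.
have Em : 1 - (2^-1 + eps * (0 - 1)) = 2^-1 + eps by lra.
have E00 : 1 - (2^-1 + eps * (0 - 0)) = 2^-1 by lra.
by case: k j kNg jk {adm} => [] [] //= _ _; rewrite ?E ?Ep ?Em ?E00; lra.
Qed.

End Network.

Theorem theorem3p1 (R : realType) (ta tb : R -> R)
    (hta : travel_time_function ta) (htb : travel_time_function tb)
    (hstrict : strictly_convex_function (`[0, 1]%classic : set R) ta \/
               strictly_convex_function (`[0, 1]%classic : set R) tb) :
  exists2 te : R, 0 <= te &
    exists theta : R,
      [/\ S2 (theta, theta),
          local_nash ta tb te (theta, theta) &
          forall p : R * R, S2 p ->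
            mean_time ta tb te (theta, theta) <= mean_time ta tb te p].
Proof.
have l01 : 0 <= (1 : R) <= 1 by lra.
have b1 := travel_time_ge0 htb l01.
have bh : tb 2^-1 <= tb 1 by apply: (travel_time_le htb); lra.
exists (tb 1 + 1); first by lra.
exists 2^-1; split; first by split => /=; lra.
- by apply: half_local_nash => //; lra.
- by move=> p; apply: half_minimizes_mean_time => //; lra.
Qed.
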